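(* For each integer $\nu\ge2$ let $n:=\binom{\nu}{2}$, let $p_n\in(0,1)$, and let $\pi(x)=p_n^{S(x)}(1-p_n)^{n-S(x)}$ for $x\in\{0,1\}^n$ be the Erdős–Rényi random graph model on $\nu$ vertices with parameter $p_n$. Put $\rho:=\rho_n:=\max\{p_n,1-p_n\}$. Then the lazy random walk Metropolis chain for this model (as $\nu\to\infty$) has cutoff at $$2\,\rho\, n\,\min\left\{\log n,\ \log\sqrt{\frac{n\rho}{1-\rho}}\right\}$$ with a window of size $n$.
   Context: For $x\in\{0,1\}^n$, $S(x)=\sum_{i=1}^n x_i$. Coordinates of $\{0,1\}^n$ are identified with the $n=\binom{\nu}{2}$ potential edges of a simple graph on $\nu$ vertices. Two states are neighbors if they differ in exactly one coordinate. Lazy random walk Metropolis chain for a positive distribution $\pi$ on $\{0,1\}^n$: at each step, flip an independent fair coin. If heads, stay at the current state $x$. If tails, choose one of the $n$ neighbors $y$ of $x$ uniformly at random, move to $y$ with probability $\min(1,\pi(y)/\pi(x))$, and otherwise stay at $x$. Its transition matrix is denoted $P$. Total variation distance: $\|\mu-\nu\|=\max_A(\mu(A)-\nu(A))$. For the chain on $\{0,1\}^n$, $d_n(t)=\max_x\|P^t(x,\cdot)-\pi\|$ for $t=0,1,2,\dots$ (non-integer times are rounded to integers, e.g. down). A sequence of chains has cutoff at $s_n$ with window size $w_n$ if $w_n=o(s_n)$, $\lim_{\alpha\to\infty}\liminf_{n\to\infty}d_n(s_n-\alpha w_n)=1$, and $\lim_{\alpha\to\infty}\limsup_{n\to\infty}d_n(s_n+\alpha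 w_n)=0$; here $n$ runs through the values $\binom{\nu}{2}$, $\nu\to\infty$. *)

(* Defs.v *)
From HB Require Import structures.
From mathcomp Require Import all_boot all_order all_algebra.
From mathcomp Require Import all_classical all_reals all_analysis.

Set Implicit Arguments.
Unset Strict Implicit.
Unset Printing Implicit Defensive.

Import Order.TTheory GRing.Theory Num.Theory.
Import numFieldNormedType.Exports.
Local Open Scope classical_set_scope.
Local Open Scope ring_scope.

Section Chains.
Variable R : realType.

(* The default value 0 of the big maximum is the value at A = set0. *)
Definition tv_dist (T : finType) (mu nu : T -> R) : R :=
  \big[Num.max/0]_(A : {set T}) (\sum_(x in A) mu x - \sum_(x in A) nu x).

(* A transition matrix on T is indexed through enum_rank : T -> 'I_#|T|. *)
Definition chain_dist (T : finType) (P : 'M[R]_#|T|) (pi : T -> R) (t : nat) : R :=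
  \big[Num.max/0]_(x : T)
    tv_dist (fun y => (P ^+ t) (enum_rank x) (enum_rank y)) pi.

(* Non-integer times are rounded down; Num.truncn sends negative times to 0,
   which for fixed alpha concerns only finitely many k when s > 0, as w = o(s). *)
Definition has_cutoff (T : nat -> finType) (P : forall k, 'M[R]_#|T k|)
    (pi : forall k, T k -> R) (s w : nat -> R) : Prop :=
  [/\ w =o_\oo s,
      limn_einf (fun k =>
        (chain_dist (P k) (pi k) (Num.truncn (s k - alpha * w k)))%:E)
        @[alpha --> +oo] --> 1%:E &
      limn_esup (fun k =>
        (chain_dist (P k) (pi k) (Num.truncn (s k + alpha * w k)))%:E)
        @[alpha --> +oo] --> 0%:E].

End Chains.

Section Metropolis.
Variables (R : realType) (I : finType).
Implicit Types x y z : {ffun I -> bool}.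

Definition neighbor x y : bool := #|[pred i | x i != y i]| == 1%N.

(* In the sum z is the proposed neighbour of x: it is accepted with
   probability min(1, pi z / pi x), otherwise the chain stays at x. *)
Definition lazy_metropolis_step (pi : {ffun I -> bool} -> R) x y : R :=
  2^-1 * (y == x)%:R +
  2^-1 * \sum_(z | neighbor x z) #|I|%:R^-1 *
    (Num.min 1 (pi z / pi x) * (y == z)%:R +
     (1 - Num.min 1 (pi z / pi x)) * (y == x)%:R).

Definition lazy_metropolis (pi : {ffun I -> bool} -> R)
    : 'M[R]_#|{ffun I -> bool}| :=
  \matrix_(i, j) lazy_metropolis_step pi (enum_val i) (enum_val j).

Definition weight x : nat := (\sum_(i : I) x i)%N.

End Metropolis.

Definition edge (nu : nat) : finType := {e : {set 'I_nu} | #|e| == 2%N}.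

Lemma card_edge (nu : nat) : #|edge nu| = 'C(nu, 2).
Proof.
rewrite card_sig -[in RHS](card_ord nu) -card_draws.
by apply: eq_card => e; rewrite !inE.
Qed.

Definition graph (nu : nat) : finType := {ffun edge nu -> bool}.

Definition erdos_renyi (R : realType) (nu : nat) (p : R) (x : graph nu) : R :=
  p ^+ weight x * (1 - p) ^+ ('C(nu, 2) - weight x).

(* Main.v *)
Require Import Defs.
From HB Require Import structures.
From mathcomp Require Import all_boot all_order all_algebra.
From mathcomp Require Import all_classical all_reals all_analysis.
From mathcomp Require Import ring lra.

Set Implicit Arguments.
Unset Strict Implicit.
Unset Printing Implicit Defensive.

Import Order.TTheory GRing.Theory Num.Theory.
Import numFieldNormedType.Exports.
Local Open Scope ring_scope.

(** Let [rho] be the larger of [p] and [1 - p], let [n] be the number of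
coordinates, and call the likelier value of a coordinate its majority value.
For a product measure the Metropolis acceptance probability of a flip is the
marginal weight of the proposed value divided by [rho], so the chain is a lazy
Gibbs sampler: each step picks a given coordinate with probability
[rate = 1 / (2 rho n)] and redraws it from its marginal ([expect1_resample]).
Hence a product of mean-zero functions of the coordinates in a set [A] is an
eigenfunction with eigenvalue [1 - |A| rate] ([expect_eigen_prod]), and the
t-step transition matrix has the explicit form [transE].

Upper bound.  Two estimates hold at every time, and each of them is sharp for
one of the two logarithms in the minimum.
- One step shrinks by [1 - rate] the largest change of a function under a
  single flip, so the distance is at most [n (1 - rate)^t]
  ([chain_dist_contraction]).  This is the coupon collector bound, which gives
  [ln n].
- Reversibility turns the chi-square distance from [x] into the return
  probability to [x] at time [2t]; summing the eigenvalues with multiplicities,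
  that distance is at most
  [exp (n rho / (1 - rho) exp (- 2 rate t)) - 1] ([chain_dist_chi2]), which
  gives [ln (sqrt (n rho / (1 - rho)))].

Lower bound.  Start with every coordinate at its minority value and let [F] be
the number of minority values minus its stationary mean.  Both the mean
[M = n rho (1 - rate)^t] and a bound [n rho (1 - rho) + M] on the variance at
time [t] come from the eigenfunctions, while the stationary variance is
[n rho (1 - rho)].  By Chebyshev the event [F >= M / 2] separates the two laws
once [M] dominates both [1] and [sqrt (n rho (1 - rho))]
([chain_dist_lower]); these two conditions again correspond to the two
logarithms.

At times [s - alpha n] and [s + alpha n] all these bounds are within
[C exp (- alpha / 2)] of [1] and [0], with [C] independent of [n] and [p]
([chain_dist_before], [chain_dist_after]), and the cutoff follows
([has_cutoff_expR]). *)

(** * Powers of a transition matrix as operators on functions *)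

Section Kernel.
Variables (R : realType) (T : finType) (P : 'M[R]_#|T|).
Implicit Types (f g : T -> R) (t : nat).

Definition trans t x y : R := (P ^+ t) (enum_rank x) (enum_rank y).

Definition expect t x f : R := \sum_y trans t x y * f y.

Lemma expect0 x f : expect 0 x f = f x.
Proof.
rewrite /expect (bigD1 x) //= big1 => [|y yx].
  by rewrite /trans expr0 mxE eqxx mul1r addr0.
by rewrite /trans expr0 mxE (inj_eq enum_rank_inj) eq_sym (negPf yx) mul0r.
Qed.

Lemma expectD s t x f :
  expect (s + t) x f = expect s x (fun y => expect t y f).
Proof.
rewrite /expect; under eq_bigr => z _.
  rewrite /trans exprD mxE (reindex enum_rank) /=; last first.
    by apply: onW_bij; exact: enum_rank_bij.
  rewrite mulr_suml; over.
rewrite exchange_big /=; apply: eq_bigr => y _.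
by rewrite mulr_sumr; apply: eq_bigr => z _; rewrite mulrA.
Qed.

Lemma eq_expect t x f g : f =1 g -> expect t x f = expect t x g.
Proof. by move=> fg; apply: eq_bigr => y _; rewrite fg. Qed.

Lemma expect_add t x f g :
  expect t x (fun y => f y + g y) = expect t x f + expect t x g.
Proof.
by rewrite /expect -big_split; apply: eq_bigr => y _; rewrite mulrDr.
Qed.

Lemma expect_scale t x c f :
  expect t x (fun y => c * f y) = c * expect t x f.
Proof. by rewrite /expect mulr_sumr; apply: eq_bigr => y _; rewrite mulrCA. Qed.

Lemma expect_sum (J : finType) (Q : pred J) t x (F : J -> T -> R) :
  expect t x (fun y => \sum_(j | Q j) F j y) = \sum_(j | Q j) expect t x (F j).
Proof.
by rewrite exchange_big; apply: eq_bigr => y _; rewrite mulr_sumr.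
Qed.

Lemma expect_delta t x y : expect t x (fun z => (z == y)%:R) = trans t x y.
Proof.
rewrite /expect (bigD1 y) //= eqxx mulr1 big1 ?addr0 // => z zy.
by rewrite (negPf zy) mulr0.
Qed.

Lemma expect_eigen c f :
  (forall x, expect 1 x f = c * f x) -> forall t x, expect t x f = c ^+ t * f x.
Proof.
move=> Ef t x; elim: t => [|t IH]; first by rewrite expect0 mul1r.
by rewrite -addn1 expectD (eq_expect _ _ Ef) expect_scale IH addn1 exprS mulrA.
Qed.

Lemma trans_ge0 : (forall x y, 0 <= trans 1 x y) ->
  forall t x y, 0 <= trans t x y.
Proof.
move=> P0 t; elim: t => [|t IH] x y.
  by rewrite -expect_delta expect0 ler0n.
rewrite -expect_delta -addn1 expectD; apply: sumr_ge0 => z _.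
by rewrite mulr_ge0 // expect_delta.
Qed.

End Kernel.

(** * Total variation distance *)

Section TotalVariation.
Variables (R : realType) (T : finType).
Implicit Types mu nu : T -> R.

Lemma tv_dist_ge mu nu (A : {set T}) :
  \sum_(x in A) mu x - \sum_(x in A) nu x <= tv_dist mu nu.
Proof. by rewrite /tv_dist (bigD1 A) //= le_max lexx. Qed.

Lemma tv_dist_le mu nu c : 0 <= c ->
  (forall A : {set T}, \sum_(x in A) mu x - \sum_(x in A) nu x <= c) ->
  tv_dist mu nu <= c.
Proof.
move=> c0 H; rewrite /tv_dist; elim/big_ind: _ => // a b ac bc.
by rewrite ge_max ac.
Qed.

Lemma tv_dist_ge0 mu nu : 0 <= tv_dist mu nu.
Proof. by have := tv_dist_ge mu nu finset.set0; rewrite !big_set0 subrr. Qed.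

Lemma chain_dist_ge (P : 'M[R]_#|T|) pi t x :
  tv_dist (trans P t x) pi <= chain_dist P pi t.
Proof. by rewrite /chain_dist (bigD1 x) //= le_max lexx. Qed.

Lemma chain_dist_le (P : 'M[R]_#|T|) pi t c : 0 <= c ->
  (forall x, tv_dist (trans P t x) pi <= c) -> chain_dist P pi t <= c.
Proof.
move=> c0 H; rewrite /chain_dist; elim/big_ind: _ => // [a b ac bc|x _].
  by rewrite ge_max ac.
exact: H.
Qed.

Lemma chain_dist_ge0 (P : 'M[R]_#|T|) pi t : 0 <= chain_dist P pi t.
Proof.
rewrite /chain_dist; elim/big_ind: _ => // [a b a0 b0|x _].
  by rewrite le_max a0.
exact: tv_dist_ge0.
Qed.

(** The inequality [u <= (u^2 / c + c) / 2], applied to [u = h x - 1], takes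
the place of Cauchy-Schwarz and avoids square roots; extending the sum from [A]
to the whole space uses that the right-hand side is nonnegative. *)
Lemma tv_dist_chi2 (pi h : T -> R) c : 0 < c ->
  (forall x, 0 <= pi x) -> \sum_x pi x = 1 ->
  \sum_x pi x * (h x - 1) ^+ 2 <= c ^+ 2 ->
  tv_dist (fun x => pi x * h x) pi <= c.
Proof.
move=> c0 pi0 pi1 chi; apply: tv_dist_le (ltW c0) _ => A.
rewrite -sumrB.
have bnd x : pi x * h x - pi x <= (c^-1 * (pi x * (h x - 1) ^+ 2) + c * pi x) / 2.
  rewrite -subr_ge0.
  have -> : (c^-1 * (pi x * (h x - 1) ^+ 2) + c * pi x) / 2 - (pi x * h x - pi x)
     = pi x * c^-1 / 2 * (h x - 1 - c) ^+ 2 by field; rewrite gt_eqF.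
  by rewrite mulr_ge0 ?sqr_ge0 // divr_ge0 ?mulr_ge0 // invr_ge0 ltW.
have bnd0 x : 0 <= (c^-1 * (pi x * (h x - 1) ^+ 2) + c * pi x) / 2.
  by rewrite divr_ge0 // addr_ge0 // mulr_ge0 ?(ltW c0) // ?invr_ge0 ?(ltW c0) // mulr_ge0 ?sqr_ge0.
apply: (@le_trans _ _ (\sum_x (c^-1 * (pi x * (h x - 1) ^+ 2) + c * pi x) / 2)).
  rewrite [leRHS](bigID (mem A)) /= -[leLHS]addr0 lerD //.
    exact: ler_sum.
  exact: sumr_ge0.
rewrite -mulr_suml big_split /= -!mulr_sumr pi1 mulr1 ler_pdivrMr // mulr2n mulrDr mulr1.
by rewrite lerD2r ler_pdivrMl // -expr2.
Qed.

End TotalVariation.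

(** * The Metropolis chain of a product measure *)

Section ProductChain.
Variables (R : realType) (I : finType) (p : R).
Hypothesis p01 : 0 < p < 1.
Hypothesis I_gt0 : (0 < #|I|)%N.
Implicit Types (x y z : {ffun I -> bool}) (A : {set I}).

Definition site (b : bool) : R := if b then p else 1 - p.

Definition bernoulli x : R := \prod_i site (x i).

Definition majority : R := Num.max p (1 - p).

Definition flip (i : I) x : {ffun I -> bool} := [ffun j => x j (+) (j == i)].

(** The probability that a given coordinate is redrawn in one step. *)
Definition rate : R := (2 * majority * #|I|%:R)^-1.

Let P := lazy_metropolis bernoulli.

Lemma site_gt0 b : 0 < site b.
Proof. by case/andP: p01 => p0 p1; case: b; rewrite /site; lra. Qed.

Lemma siteN b : site (~~ b) = 1 - site b.
Proof. by case: b => //=; rewrite opprB addrC subrK. Qed.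

Lemma bernoulli_gt0 x : 0 < bernoulli x.
Proof. by apply: prodr_gt0 => i _; exact: site_gt0. Qed.

Lemma majority_bounds : 2^-1 <= majority < 1.
Proof.
case/andP: p01 => p0 p1; rewrite /majority; apply/andP; split; last by rewrite gt_max p1 /=; lra.
by rewrite le_max; case: (leP p 2^-1) => ?; apply/orP; [right|left]; lra.
Qed.

Lemma site_le_majority b : site b <= majority.
Proof. by case: b; rewrite /majority le_max lexx ?orbT. Qed.

Lemma majority_site : exists b, site b = majority.
Proof.
rewrite /majority; case: (leP p (1 - p)) => h; first by exists false.
by exists true.
Qed.

Lemma card_gt0R : 0 < #|I|%:R :> R. Proof. by rewrite ltr0n. Qed.

Lemma rate_gt0 : 0 < rate.
Proof.
have /andP[m0 _] := majority_bounds; have n0 := card_gt0R.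
by rewrite invr_gt0 !mulr_gt0 //; lra.
Qed.

Lemma rate_card_le1 : #|I|%:R * rate <= 1.
Proof.
have /andP[m0 _] := majority_bounds; have n0 := card_gt0R.
rewrite /rate invfM mulrCA divff ?gt_eqF // mulr1 invf_le1; lra.
Qed.

Lemma rate_le1 : rate <= 1.
Proof.
rewrite (le_trans _ rate_card_le1) // ler_peMl ?(ltW rate_gt0) //.
by rewrite ler1n.
Qed.

Lemma flipE i x j : flip i x j = x j (+) (j == i). Proof. by rewrite ffunE. Qed.

Lemma flip_inj x : injective (flip^~ x).
Proof.
move=> i j /(congr1 (fun f : {ffun I -> bool} => f i)).
rewrite !flipE eqxx => /addbI; by case: eqP.
Qed.

Lemma neighborP x z : reflect (exists i, z = flip i x) (neighbor x z).
Proof.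
rewrite /neighbor; apply: (iffP card1P) => [[i xz]|[i ->]]; exists i.
  apply/ffunP => j; rewrite flipE.
  by have := xz j; rewrite !inE => <-; case: (x j) (z j) => [] [].
by move=> j; rewrite !inE flipE; case: (x j) (j == i) => [] [].
Qed.

Lemma sum_neighbor x (F : {ffun I -> bool} -> R) :
  \sum_(z | neighbor x z) F z = \sum_i F (flip i x).
Proof.
transitivity (\sum_(z in [set flip i x | i in I]%SET) F z).
  apply: eq_bigl => z; apply/neighborP/imsetP => [[i ->]|[i _ ->]].
    by exists i.
  by exists i.
by rewrite big_imset //= => i j _ _; exact: flip_inj.
Qed.

Lemma bernoulli_flip i x :
  bernoulli (flip i x) / bernoulli x = site (~~ x i) / site (x i).
Proof.
rewrite /bernoulli (bigD1 i) //= [in X in _ / X](bigD1 i) //= flipE eqxx addbT.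
rewrite (eq_bigr (fun j => site (x j))); last first.
  by move=> j ji; rewrite flipE (negPf ji) addbF.
have : 0 < \prod_(j | j != i) site (x j) by apply: prodr_gt0 => j _; exact: site_gt0.
have := site_gt0 (x i).
by move=> h1 h2; field; rewrite !gt_eqF.
Qed.

(** The likelier of the two values has marginal weight [majority].  If it is
the proposed one, both sides are [1]; otherwise it is the current one.  So the
acceptance probability is a fixed multiple of the marginal weight of the
proposed value, which is what makes the chain a Gibbs sampler. *)
Lemma accept_site b :
  Num.min 1 (site (~~ b) / site b) = site (~~ b) / majority.
Proof.
have s0 := site_gt0 b; have sn0 := site_gt0 (~~ b).
have -> : majority = Num.max (site b) (site (~~ b)).
  by case: (b) => //=; rewrite /majority maxC.
case: (leP (site b) (site (~~ b))) => h.
  by rewrite divff ?gt_eqF //; apply/min_idPl; rewrite ler_pdivlMr // mul1r.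
by apply/min_idPr; rewrite ler_pdivrMr // mul1r ltW.
Qed.

Lemma trans1 x y : trans P 1 x y = lazy_metropolis_step bernoulli x y.
Proof. by rewrite /trans expr1 mxE !enum_rankK. Qed.

Lemma sum_delta x (f : {ffun I -> bool} -> R) : \sum_y (y == x)%:R * f y = f x.
Proof.
rewrite (bigD1 x) //= eqxx mul1r big1 ?addr0 // => y yx.
by rewrite (negPf yx) mul0r.
Qed.

(** The factor [rate] combines the laziness [1/2], the uniform choice [1/n]
of a coordinate and the factor [1 / majority] in the acceptance
probability. *)
Lemma expect1E x f :
  expect P 1 x f =
  f x + rate * \sum_i site (~~ x i) * (f (flip i x) - f x).
Proof.
have n0 := card_gt0R; have /andP[m0 _] := majority_bounds.
rewrite /expect; under eq_bigr => y _.
  rewrite trans1 /lazy_metropolis_step sum_neighbor mulrDl -!mulrA mulr_suml mulr_sumr.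
  under eq_bigr do rewrite -[_ * f y]mulrA [_ * f y]mulrDl -!mulrA bernoulli_flip accept_site.
  over.
rewrite big_split /= -mulr_sumr sum_delta exchange_big /=.
under eq_bigr => i _.
  under eq_bigr do rewrite mulrA.
  rewrite -mulr_sumr big_split /= -!mulr_sumr !sum_delta.
  rewrite (_ : _ * _ = (2 * #|I|%:R)^-1 * f x + rate * (site (~~ x i) * (f (flip i x) - f x)));
    last by rewrite /rate; field; rewrite !gt_eqF //; lra.
  over.
rewrite big_split /= -!mulr_sumr sumr_const -mulr_natl.
by field; rewrite gt_eqF.
Qed.

Lemma trans1_ge0 x y : 0 <= trans P 1 x y.
Proof.
have /andP[m0 _] := majority_bounds.
rewrite trans1 /lazy_metropolis_step sum_neighbor addr_ge0 //.
rewrite mulr_ge0 ?invr_ge0 // sumr_ge0 // => i _.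
rewrite mulr_ge0 ?invr_ge0 // bernoulli_flip accept_site.
have s0 := site_gt0 (~~ x i); have sm := site_le_majority (~~ x i).
rewrite addr_ge0 // mulr_ge0 //; first by rewrite divr_ge0 //; lra.
by rewrite subr_ge0 ler_pdivrMr ?mul1r //; lra.
Qed.

(** Redrawing a coordinate in [A] averages its mean-zero factor to [0], and
redrawing any other coordinate leaves the product unchanged. *)
Lemma expect_eigen_prod A (g : I -> bool -> R) :
  (forall i, i \in A -> site true * g i true + site false * g i false = 0) ->
  forall t x, expect P t x (fun y => \prod_(i in A) g i (y i)) =
    (1 - #|A|%:R * rate) ^+ t * \prod_(i in A) g i (x i).
Proof.
move=> g0; apply: expect_eigen => x.
pose Phi y := \prod_(i in A) g i (y i).
rewrite -/(Phi x) -[LHS]/(expect P 1 x Phi) expect1E.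
suff -> : \sum_i site (~~ x i) * (Phi (flip i x) - Phi x) = - (#|A|%:R * Phi x).
  by ring.
rewrite (bigID (mem A)) /= [X in _ + X]big1 ?addr0 => [|i iA]; last first.
  rewrite (_ : Phi (flip i x) = Phi x) ?subrr ?mulr0 //.
  apply: eq_bigr => j jA; rewrite flipE.
  by case: eqP jA iA => [-> ->//|]; rewrite addbF.
transitivity (\sum_(i in A) - Phi x); last first.
  by rewrite sumr_const mulNrn mulr_natl.
apply: eq_bigr => i iA; rewrite /Phi (bigD1 i) //= [in X in _ - X](bigD1 i) //= flipE eqxx addbT.
rewrite [in X in _ * X - _](eq_bigr (fun j => g j (x j))); last first.
  by move=> j /andP[_ ji]; rewrite flipE (negPf ji) addbF.
rewrite [in RHS](bigD1 i) //= -mulrBl mulrA -mulNr; congr (_ * _).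
have cancel b : site (~~ b) * g i (~~ b) = - (site b * g i b).
  by apply/eqP; rewrite -addr_eq0; case: b => /=; rewrite ?[_ + site true * _]addrC g0.
by rewrite mulrBr cancel siteN; ring.
Qed.

(** * Spectral expansion and the chi-square bound *)

Local Arguments site : simpl never.

(** The factor for [i] is the density of the point mass at [y i] with
respect to the marginal, minus [1]: it has mean zero in [x i], and it is
symmetric in [x] and [y]. *)
Definition centred A x y : R :=
  \prod_(i in A) ((x i == y i)%:R / site (y i) - 1).

(** The t-step transition probability relative to the stationary
measure. *)
Definition density t x y : R :=
  \sum_(A : {set I}) (1 - #|A|%:R * rate) ^+ t * centred A x y.

Lemma centred_sym A x y : centred A x y = centred A y x.
Proof. by apply: eq_bigr => i _; rewrite eq_sym; case: eqP => [->|]; rewrite ?mul0r. Qed.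

Lemma density_sym t x y : density t x y = density t y x.
Proof. by apply: eq_bigr => A _; rewrite centred_sym. Qed.

Lemma prod_1D (F : I -> R) :
  \prod_i (1 + F i) = \sum_(A : {set I}) \prod_(i in A) F i.
Proof.
under eq_bigr do rewrite addrC.
by rewrite bigA_distr; apply: eq_bigr => A _; rewrite [RHS]big_mkcond.
Qed.

(** Expanding the product over [i] of [1 + factor i] gives the decomposition
of a point mass into eigenfunctions. *)
Lemma delta_expansion x y :
  (x == y)%:R = bernoulli y * \sum_(A : {set I}) centred A x y.
Proof.
rewrite -prod_1D -big_split /=.
have E i : site (y i) * (1 + ((x i == y i)%:R / site (y i) - 1)) = (x i == y i)%:R.
  by rewrite [1 + _]addrC subrK mulrC divfK ?(gt_eqF (site_gt0 _)).
under eq_bigr do rewrite E.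
have [->|/eqP] := eqVneq x y; first by rewrite big1 // => i _; rewrite eqxx.
move=> xy; have [i xyi] : exists i, x i != y i.
  apply/existsP; rewrite -negb_forall; apply/negP => /forallP xy'.
  by apply: xy; apply/ffunP => i; apply/eqP.
by rewrite (bigD1 i) //= (negPf xyi) mul0r.
Qed.

Lemma expect_centred t A x y :
  expect P t x (fun z => centred A z y) =
  (1 - #|A|%:R * rate) ^+ t * centred A x y.
Proof.
apply: (@expect_eigen_prod A (fun i b => (b == y i)%:R / site (y i) - 1)) => i _.
have s0 := site_gt0 (y i); have sN : site false = 1 - site true := siteN true.
move: s0 sN; case: (y i) => /= s0 sN.
  by rewrite mul0r div1r sN; field; rewrite gt_eqF.
by rewrite mul0r div1r sN; field; rewrite -sN gt_eqF.
Qed.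

Lemma transE t x y : trans P t x y = bernoulli y * density t x y.
Proof.
rewrite -expect_delta (eq_expect _ _ _ (fun z => delta_expansion z y)).
rewrite expect_scale expect_sum; congr (_ * _).
by apply: eq_bigr => A _; rewrite expect_centred.
Qed.

Lemma bernoulli_trans t x y :
  bernoulli x * trans P t x y = bernoulli y * trans P t y x.
Proof. by rewrite !transE density_sym mulrCA. Qed.

Lemma expect_cst t x c : expect P t x (fun=> c) = c.
Proof.
rewrite (@expect_eigen _ _ _ 1) ?expr1n ?mul1r // => y.
rewrite expect1E big1 ?mulr0 ?addr0 ?mul1r // => i _.
by rewrite subrr mulr0.
Qed.

Lemma sum_trans t x : \sum_y trans P t x y = 1.
Proof.
by rewrite -[RHS](expect_cst t x 1); apply: eq_bigr => y _; rewrite mulr1.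
Qed.

Lemma sum_bernoulli : \sum_x bernoulli x = 1.
Proof.
rewrite -(bigA_distr_bigA (fun (_ : I) b => site b)) big1 // => i _.
by rewrite big_bool /= (siteN true : site false = _); ring.
Qed.

(** Summing the detailed balance equation [bernoulli_trans]. *)
Lemma stationary t f :
  \sum_x bernoulli x * expect P t x f = \sum_y bernoulli y * f y.
Proof.
under eq_bigr do rewrite mulr_sumr.
rewrite exchange_big /=; apply: eq_bigr => y _.
under eq_bigr do rewrite mulrA bernoulli_trans -mulrA [_ * f y]mulrC mulrA.
by rewrite -mulr_sumr sum_trans mulr1.
Qed.

(** By symmetry of the density, the sum over [y] of [trans t x y] times
[density t x y] is a two-stage expectation, that is, the density at time
[2t]. *)
Lemma chi2_density t x :
  \sum_y bernoulli y * (density t x y - 1) ^+ 2 = density (t + t) x x - 1.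
Proof.
have E y : bernoulli y * (density t x y - 1) ^+ 2 =
    trans P t x y * density t y x - 2 * trans P t x y + bernoulli y.
  by rewrite transE [density t y x]density_sym; ring.
under eq_bigr do rewrite E.
rewrite big_split /= sumrB -mulr_sumr sum_trans sum_bernoulli.
rewrite -[X in X - _ + _]/(expect P t x (fun y => density t y x)).
rewrite expect_sum (_ : \sum_A _ = density (t + t) x x); first by ring.
apply: eq_bigr => A _; rewrite expect_scale expect_centred mulrA.
by rewrite -exprD.
Qed.

Lemma card_rate_ge0 A : 0 <= 1 - #|A|%:R * rate.
Proof.
rewrite subr_ge0 (le_trans _ rate_card_le1) // ler_wpM2r ?(ltW rate_gt0) //.
by rewrite ler_nat max_card.
Qed.

Lemma centred_diag_bounds A x :
  0 <= centred A x x <= (majority / (1 - majority)) ^+ #|A|.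
Proof.
have B i : 0 <= (x i == x i)%:R / site (x i) - 1 <= majority / (1 - majority).
  have s0 := site_gt0 (x i); have := site_le_majority (~~ x i).
  have sn0 := site_gt0 (~~ x i).
  have /andP[m0 m1] := majority_bounds.
  move: s0 sn0; rewrite siteN eqxx mulr1n => s0 sn0 sm; apply/andP; split.
    by rewrite subr_ge0 ler_pdivlMr // mul1r; lra.
  rewrite lerBlDr (_ : _ + 1 = (1 - majority)^-1); last by field; rewrite gt_eqF; lra.
  by rewrite div1r lef_pV2 ?posrE //; lra.
rewrite /centred prodr_ge0 => [|i _]; last by case/andP: (B i).
rewrite -prodr_const; apply: ler_prod => i _; exact: B.
Qed.

(** Bounding the eigenvalue [1 - |A| rate] by [exp (- |A| rate)] makes every
term a product over [A], so the sum over [A] becomes a power [(1 + c)^n]. *)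
Lemma density_diag_le t x :
  density t x x <=
  expR (#|I|%:R * (expR (- rate) ^+ t * (majority / (1 - majority)))).
Proof.
set c := expR (- rate) ^+ t * _.
have /andP[m0 m1] := majority_bounds.
have c0 : 0 <= c.
  by rewrite mulr_ge0 ?exprn_ge0 ?expR_ge0 // divr_ge0 //; lra.
apply: (@le_trans _ _ ((1 + c) ^+ #|I|)); last first.
  rewrite mulrC expRM_natr lerXn2r ?nnegrE ?expR_ge0 ?expR_ge1Dx //; lra.
rewrite -prodr_const prod_1D; apply: ler_sum => A _.
rewrite prodr_const exprMn exprAC; have /andP[C0 C1] := centred_diag_bounds A x.
apply: ler_pM => //; first by rewrite exprn_ge0 ?card_rate_ge0.
rewrite lerXn2r ?nnegrE ?card_rate_ge0 ?exprn_ge0 ?expR_ge0 //.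
by rewrite -expRM_natl mulrN expR_ge1Dx.
Qed.

Lemma chain_dist_chi2 t c : 0 < c ->
  expR (#|I|%:R * (expR (- rate) ^+ (t + t) * (majority / (1 - majority)))) - 1
    <= c ^+ 2 ->
  chain_dist P bernoulli t <= c.
Proof.
move=> c0 H; apply: chain_dist_le (ltW c0) _ => x.
rewrite (_ : trans P t x = fun y => bernoulli y * density t x y); last first.
  by apply/funext => y; rewrite transE.
apply: tv_dist_chi2 => // [y||]; first exact/ltW/bernoulli_gt0.
  exact: sum_bernoulli.
by rewrite chi2_density (le_trans _ H) // lerD2r density_diag_le.
Qed.

(** * Contraction of the oscillation *)

(** The Gibbs update of coordinate [i]. *)
Definition resample i (f : {ffun I -> bool} -> R) x : R :=
  site (~~ x i) * f (flip i x) + site (x i) * f x.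

Lemma expect1_resample x f :
  expect P 1 x f =
  (1 - #|I|%:R * rate) * f x + rate * \sum_i resample i f x.
Proof.
rewrite expect1E.
have E i : site (~~ x i) * (f (flip i x) - f x) = resample i f x - f x.
  by rewrite /resample siteN; ring.
under eq_bigr do rewrite E.
by rewrite sumrB sumr_const -[f x *+ _]mulr_natl; ring.
Qed.

Lemma flipC i j x : flip i (flip j x) = flip j (flip i x).
Proof. by apply/ffunP => k; rewrite !flipE addbAC. Qed.

Lemma flipK i x : flip i (flip i x) = x.
Proof. by apply/ffunP => k; rewrite !flipE addbK. Qed.

Lemma resample_flip i f x : resample i f (flip i x) = resample i f x.
Proof. by rewrite /resample flipK flipE eqxx addbT negbK addrC. Qed.

(** Of the [n] coordinates that may be redrawn, the one where the two
arguments differ erases the difference and the others do not increase it. *)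
Lemma flip_contraction (D : R) (f : {ffun I -> bool} -> R) : 0 <= D ->
  (forall i x, `|f (flip i x) - f x| <= D) ->
  forall t i x, `|expect P t (flip i x) f - expect P t x f| <= (1 - rate) ^+ t * D.
Proof.
move=> D0 fD t; elim: t => [|t IH] i x.
  by rewrite !expect0 mul1r.
rewrite -add1n !expectD; set g := fun y => expect P t y f.
set D' := (1 - rate) ^+ t * D in IH.
have r0 := rate_gt0; have nr1 := rate_card_le1.
have resampleD j : `|resample j g (flip i x) - resample j g x| <= (j != i)%:R * D'.
  have [->|ji] := eqVneq j i; first by rewrite resample_flip subrr normr0 mul0r.
  rewrite /resample flipE (negPf ji) addbF flipC siteN mul1r.
  set s := site (x j).
  have s0 : 0 < s := site_gt0 _; have s1 : 0 < 1 - s by rewrite -siteN site_gt0.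
  rewrite (_ : _ - _ = (1 - s) * (g (flip i (flip j x)) - g (flip j x)) +
     s * (g (flip i x) - g x)); last by ring.
  rewrite (le_trans (ler_normD _ _)) // !normrM (gtr0_norm s0) (gtr0_norm s1).
  have h1 := IH i (flip j x); have h2 := IH i x.
  rewrite (_ : D' = (1 - s) * D' + s * D'); last by ring.
  by apply: lerD; rewrite ler_pM2l.
rewrite !expect1_resample.
rewrite (_ : _ - _ = (1 - #|I|%:R * rate) * (g (flip i x) - g x) +
   rate * \sum_j (resample j g (flip i x) - resample j g x)); last first.
  by rewrite sumrB; ring.
rewrite (le_trans (ler_normD _ _)) // !normrM (ger0_norm (ltW r0)).
rewrite ger0_norm; last by lra.
rewrite (_ : (1 - rate) ^+ (1 + t) * D = (1 - #|I|%:R * rate) * D' +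
   rate * ((#|I|%:R - 1) * D')); last by rewrite /D' exprS; ring.
apply: lerD; first by rewrite ler_wpM2l ?IH //; lra.
rewrite ler_pM2l // (le_trans (ler_norm_sum _ _ _)) //.
apply: (@le_trans _ _ (\sum_j (j != i)%:R * D')); first exact: ler_sum.
rewrite -mulr_suml (bigD1 i) //= eqxx add0r.
rewrite (eq_bigr (fun=> 1)) => [|j ji]; last by rewrite ji.
rewrite sumr_const; have -> : #|[pred j | j != i]| = #|I|.-1.
  by rewrite -(cardC1 i); apply: eq_card.
by rewrite -subn1 natrB.
Qed.

Lemma flip_path (D : R) (f : {ffun I -> bool} -> R) :
  (forall i x, `|f (flip i x) - f x| <= D) ->
  forall x y, `|f x - f y| <= #|I|%:R * D.
Proof.
move=> fD x y.
have D0 : 0 <= D.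
  by case/card_gt0P: I_gt0 => i _; exact: le_trans (normr_ge0 _) (fD i x).
suff H k : #|[pred i | x i != y i]| = k -> `|f x - f y| <= k%:R * D.
  by rewrite (le_trans (H _ erefl)) // ler_wpM2r // ler_nat max_card.
elim: k x => [|k IH] x xy.
  rewrite (_ : x = y) ?subrr ?normr0 ?mul0r //; apply/ffunP => i.
  by have := card0_eq xy i; rewrite !inE => /negbFE/eqP.
have [i] : exists i, i \in [pred i | x i != y i].
  by apply/card_gt0P; rewrite xy.
rewrite inE => xyi.
have /IH fk : #|[pred j | flip i x j != y j]| = k.
  move: xy; rewrite (cardD1 i) inE xyi add1n => -[<-].
  apply: eq_card => j; rewrite !inE flipE.
  have [->|_] := eqVneq j i; last by rewrite addbF.
  by move: xyi; case: (x i) (y i) => [] [].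
rewrite -[f x](subrK (f (flip i x))) -addrA (le_trans (ler_normD _ _)) //.
by rewrite -natr1 mulrDl mul1r [leRHS]addrC lerD // distrC.
Qed.

(** By stationarity the difference between the two measures of [A] is an
average of differences of the t-step probabilities of [A] from two starting
states, and such states are joined by at most [n] flips. *)
Lemma chain_dist_contraction t :
  chain_dist P bernoulli t <= #|I|%:R * (1 - rate) ^+ t.
Proof.
have n0 := card_gt0R.
have r1 : 0 <= 1 - rate by rewrite subr_ge0 rate_le1.
have B0 : 0 <= #|I|%:R * (1 - rate) ^+ t by rewrite mulr_ge0 ?exprn_ge0 // ltW.
apply: chain_dist_le => // x; apply: tv_dist_le => // A.
pose f y : R := (y \in A)%:R.
have -> : \sum_(y in A) trans P t x y = expect P t x f.
  rewrite big_mkcond; apply: eq_bigr => y _.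
  by rewrite /f; case: ifP; rewrite ?mulr1 ?mulr0.
have -> : \sum_(y in A) bernoulli y = \sum_y bernoulli y * expect P t y f.
  rewrite stationary big_mkcond; apply: eq_bigr => y _.
  by rewrite /f; case: ifP; rewrite ?mulr1 ?mulr0.
rewrite -[expect P t x f]mul1r -[X in X * _ - _]sum_bernoulli mulr_suml -sumrB.
rewrite -[leRHS]mul1r -[X in _ <= X * _]sum_bernoulli mulr_suml; apply: ler_sum => y _.
rewrite -mulrBr ler_pM2l ?bernoulli_gt0 //.
apply: le_trans (ler_norm _) _.
apply: (@flip_path _ (fun z => expect P t z f)) => i z.
rewrite -[leRHS]mulr1; apply: flip_contraction => // j w.
by rewrite /f; do 2!case: (_ \in A);
   rewrite ?subrr ?normr0 ?subr0 ?sub0r ?normrN ?normr1.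
Qed.

Lemma chain_dist_le1 t : chain_dist P bernoulli t <= 1.
Proof.
apply: chain_dist_le => // x; apply: tv_dist_le => // A.
have tr0 := trans_ge0 trans1_ge0 t x.
rewrite -(sum_trans t x) [leRHS](bigID (mem A)) /= lerD //.
rewrite (@le_trans _ _ 0) ?oppr_le0 ?sumr_ge0 // => y _.
exact/ltW/bernoulli_gt0.
Qed.

(** * Second moment method for the number of minority values *)

(** By stationarity the mean is multiplied by the eigenvalue of the
function, which differs from [1] as [A] is nonempty. *)
Lemma bernoulli_eigen_prod A (g : I -> bool -> R) : A != finset.set0 ->
  (forall i, i \in A -> site true * g i true + site false * g i false = 0) ->
  \sum_y bernoulli y * \prod_(i in A) g i (y i) = 0.
Proof.
move=> A0 g0; set S := \sum_y _.
have : S = (1 - #|A|%:R * rate) * S.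
  rewrite {1}/S -(stationary 1) mulr_sumr; apply: eq_bigr => y _.
  by rewrite expect_eigen_prod // expr1 mulrCA.
have k0 : #|A|%:R * rate != 0.
  by rewrite mulf_neq0 ?gt_eqF ?rate_gt0 // ltr0n card_gt0.
rewrite mulrBl mul1r => /eqP; rewrite -subr_eq0 opprB addrCA subrr addr0.
by rewrite mulf_eq0 (negPf k0) => /eqP.
Qed.

Section MinorityCount.
Variable a : bool.
Hypothesis site_a : site a = 1 - majority.

Definition minority (b : bool) : R := (b == a)%:R - site a.

Definition excess x : R := \sum_i minority (x i).

Lemma minority_mean : site true * minority true + site false * minority false = 0.
Proof. by rewrite /minority (siteN true); case: (a); rewrite /= ?(siteN true); ring. Qed.

Lemma minority_self : minority a = majority.
Proof. by rewrite /minority eqxx mulr1n site_a; ring. Qed.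

(** A two-valued function satisfies a quadratic equation, which expresses
its square by eigenfunctions. *)
Lemma minority_sqr b :
  minority b ^+ 2 = majority * (1 - majority) + (2 * majority - 1) * minority b.
Proof. by rewrite /minority site_a; case: eqP => _ /=; ring. Qed.

Lemma excess_sqr x :
  excess x ^+ 2 = \sum_i \sum_j minority (x i) * minority (x j).
Proof.
by rewrite expr2 {1}/excess mulr_suml; apply: eq_bigr => i _; rewrite mulr_sumr.
Qed.

Lemma expect_minority t x i :
  expect P t x (fun y => minority (y i)) = (1 - rate) ^+ t * minority (x i).
Proof.
have := @expect_eigen_prod [set i] (fun=> minority) (fun _ _ => minority_mean) t x.
by rewrite cards1 mul1r big_set1 => <-; apply: eq_expect => y; rewrite big_set1.
Qed.

Lemma prod_set2 i j (F : I -> R) : i != j ->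
  \prod_(k in [set i; j]%SET) F k = F i * F j.
Proof. by move=> ij; rewrite big_setU1 ?big_set1 ?inE. Qed.

Lemma expect_minority2 t x i j : i != j ->
  expect P t x (fun y => minority (y i) * minority (y j)) =
  (1 - 2 * rate) ^+ t * (minority (x i) * minority (x j)).
Proof.
move=> ij.
have := @expect_eigen_prod [set i; j] (fun=> minority) (fun _ _ => minority_mean) t x.
rewrite cards2 ij prod_set2 // => <-.
by apply: eq_expect => y; rewrite prod_set2.
Qed.

Lemma bernoulli_excess_sqr :
  \sum_y bernoulli y * excess y ^+ 2 = #|I|%:R * (majority * (1 - majority)).
Proof.
have one i : \sum_y bernoulli y * minority (y i) = 0.
  have := @bernoulli_eigen_prod [set i] (fun=> minority).
  rewrite -card_gt0 cards1 => /(_ isT (fun _ _ => minority_mean)) E.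
  by rewrite -[RHS]E; apply: eq_bigr => y _; rewrite big_set1.
have two i j : \sum_y bernoulli y * (minority (y i) * minority (y j)) =
    (i == j)%:R * (majority * (1 - majority)).
  have [->|ij] := eqVneq i j.
    under eq_bigr do rewrite -expr2 minority_sqr mulrDr [_ * (_ * minority _)]mulrCA.
    by rewrite big_split /= -mulr_sumr -mulr_suml one sum_bernoulli mulr0 addr0.
  have := @bernoulli_eigen_prod [set i; j] (fun=> minority).
  rewrite -card_gt0 cards2 ij => /(_ isT (fun _ _ => minority_mean)) E.
  by rewrite mul0r -[RHS]E; apply: eq_bigr => y _; rewrite prod_set2.
under eq_bigr do rewrite excess_sqr mulr_sumr.
rewrite exchange_big /=.
transitivity (\sum_(i : I) majority * (1 - majority)); last first.
  by rewrite sumr_const mulr_natl.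
apply: eq_bigr => i _; under eq_bigr do rewrite mulr_sumr.
rewrite exchange_big /=; under eq_bigr do rewrite two.
by rewrite -mulr_suml (bigD1 i) //= eqxx big1 ?addr0 ?mul1r // => j;
  rewrite eq_sym => /negPf ->.
Qed.

Let x0 : {ffun I -> bool} := [ffun=> a].

Lemma expect_excess t :
  expect P t x0 excess = #|I|%:R * majority * (1 - rate) ^+ t.
Proof.
rewrite expect_sum (eq_bigr (fun=> majority * (1 - rate) ^+ t)) => [|i _].
  by rewrite sumr_const -mulrA mulr_natl.
by rewrite expect_minority ffunE minority_self mulrC.
Qed.

(** For distinct [i] and [j] the eigenvalue [1 - 2 rate] is at most
[(1 - rate)^2]: the coordinates are negatively correlated, so only the diagonal
terms can exceed the square of the mean. *)
Lemma expect_excess_sqr t (M := #|I|%:R * majority * (1 - rate) ^+ t) :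
  expect P t x0 (fun y => excess y ^+ 2) <=
  M ^+ 2 + #|I|%:R * (majority * (1 - majority)) + M.
Proof.
have /andP[m0 m1] := majority_bounds; have r0 := rate_gt0.
set v := majority * (1 - majority); set e := majority * (1 - rate) ^+ t.
have r1 : 0 <= 1 - rate by rewrite subr_ge0 rate_le1.
have e0 : 0 <= e by rewrite mulr_ge0 ?exprn_ge0 //; lra.
have two i j : expect P t x0 (fun y => minority (y i) * minority (y j)) <=
    e ^+ 2 + (i == j)%:R * (v + e).
  have [->|ij] := eqVneq i j.
    rewrite (eq_expect _ _ _ (g := fun y => v + (2 * majority - 1) * minority (y j))).
      rewrite expect_add expect_scale expect_cst expect_minority ffunE minority_self.
      rewrite [_ ^+ t * _]mulrC -/e mul1r addrCA lerD2l.
      have := sqr_ge0 e; nra.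
    by move=> y; rewrite -expr2 minority_sqr.
  rewrite expect_minority2 // !ffunE minority_self mul0r addr0.
  rewrite /e exprMn exprAC [leRHS]mulrC ler_wpM2r ?mulr_ge0 //; try lra.
  have := card_rate_ge0 [set i; j]; rewrite cards2 ij => r2.
  rewrite lerXn2r ?nnegrE ?sqr_ge0 //; nra.
rewrite (eq_expect _ _ _ excess_sqr) expect_sum.
under eq_bigr do rewrite expect_sum.
apply: (@le_trans _ _ (\sum_i \sum_j (e ^+ 2 + (i == j)%:R * (v + e)))).
  by apply: ler_sum => i _; apply: ler_sum => j _; exact: two.
rewrite (eq_bigr (fun=> #|I|%:R * e ^+ 2 + (v + e))) => [|i _].
  rewrite sumr_const -[_ *+ _]mulr_natl.
  by rewrite le_eqVlt; apply/orP; left; apply/eqP; rewrite /M /e; ring.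
rewrite big_split /= sumr_const -[_ *+ _]mulr_natl; congr (_ + _).
by rewrite (bigD1 i) //= eqxx mul1r big1 ?addr0 // => j;
  rewrite eq_sym => /negPf ->; rewrite mul0r.
Qed.

(** Chebyshev inequality for [excess] under both laws, with the threshold
[M / 2] halfway between the two means [M] and [0]. *)
Lemma chain_dist_excess t (M := #|I|%:R * majority * (1 - rate) ^+ t) :
  0 < M ->
  1 - 4 * (2 * (#|I|%:R * (majority * (1 - majority))) + M) / M ^+ 2 <=
  chain_dist P bernoulli t.
Proof.
move=> M0; set V := #|I|%:R * _.
pose A := [set y | M / 2 <= excess y]%SET.
have M20 : 0 < 4 / M ^+ 2 by rewrite divr_gt0 // exprn_gt0.
apply: le_trans (chain_dist_ge _ _ _ x0).
apply: le_trans (tv_dist_ge _ _ A).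
have stat : \sum_(y in A) bernoulli y <= 4 / M ^+ 2 * V.
  rewrite /V -bernoulli_excess_sqr mulr_sumr [leRHS](bigID (mem A)) /= -[leLHS]addr0.
  have pos y : 0 <= 4 / M ^+ 2 * (bernoulli y * excess y ^+ 2).
    by rewrite mulr_ge0 ?(ltW M20) // mulr_ge0 ?sqr_ge0 // ltW // bernoulli_gt0.
  apply: lerD; last exact: sumr_ge0.
  apply: ler_sum => y; rewrite inE => Fy.
  rewrite mulrCA ler_peMr ?(ltW (bernoulli_gt0 _)) //.
  rewrite mulrAC ler_pdivlMr ?exprn_gt0 // mul1r; nra.
have out : \sum_(y in ~: A) trans P t x0 y <= 4 / M ^+ 2 * (V + M).
  have var : expect P t x0 (fun y => (excess y - M) ^+ 2) <= V + M.
    rewrite (eq_expect _ _ _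
      (g := fun y => excess y ^+ 2 + ((- 2 * M) * excess y + M ^+ 2))); last first.
      by move=> y; ring.
    rewrite !expect_add expect_scale expect_cst expect_excess -/M.
    have /= := expect_excess_sqr t; rewrite -/M -/V; lra.
  apply: (@le_trans _ _ (4 / M ^+ 2 * expect P t x0 (fun y => (excess y - M) ^+ 2)));
    last by rewrite ler_pM2l.
  have tr0 := trans_ge0 trans1_ge0 t x0.
  rewrite mulr_sumr [leRHS](bigID (mem (~: A))) /= -[leLHS]addr0.
  apply: lerD; last first.
    by apply: sumr_ge0 => y _; rewrite mulr_ge0 ?(ltW M20) // mulr_ge0 ?sqr_ge0.
  apply: ler_sum => y; rewrite !inE -ltNge => Fy.
  rewrite mulrCA ler_peMr // mulrAC ler_pdivlMr ?exprn_gt0 // mul1r; nra.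
have := sum_trans t x0; rewrite (bigID (mem A)) /=.
have -> : \sum_(y | y \notin A) trans P t x0 y = \sum_(y in ~: A) trans P t x0 y.
  by apply: eq_bigl => y; rewrite finset.in_setC.
move=> tot.
have -> : 4 * (2 * V + M) / M ^+ 2 = 4 / M ^+ 2 * (V + M) + 4 / M ^+ 2 * V.
  by field; rewrite gt_eqF.
lra.
Qed.

End MinorityCount.

Lemma chain_dist_lower t (M := #|I|%:R * majority * (1 - rate) ^+ t) :
  0 < M ->
  1 - 4 * (2 * (#|I|%:R * (majority * (1 - majority))) + M) / M ^+ 2 <=
  chain_dist P bernoulli t.
Proof.
have [b sb] := majority_site.
by apply: (@chain_dist_excess (~~ b)); rewrite siteN sb.
Qed.

(** * Bounds around the cutoff time *)

Definition cutoff_scale : R :=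
  Num.min (ln #|I|%:R)
    (ln (Num.sqrt (#|I|%:R * majority / (1 - majority)))).

Definition cutoff_time : R := 2 * majority * #|I|%:R * cutoff_scale.

Let ratio : R := #|I|%:R * majority / (1 - majority).

Lemma ratio_ge_card : #|I|%:R <= ratio.
Proof.
have /andP[m0 m1] := majority_bounds; have n0 := card_gt0R.
by rewrite /ratio ler_pdivlMr; [rewrite ler_pM2l //; lra|lra].
Qed.

Lemma ratio_gt0 : 0 < ratio.
Proof. exact: lt_le_trans card_gt0R ratio_ge_card. Qed.

Lemma expR_ln_card : expR (ln #|I|%:R) = #|I|%:R :> R.
Proof. by rewrite lnK // posrE card_gt0R. Qed.

Lemma expR_ln_ratio : expR (ln ratio) = ratio.
Proof. by rewrite lnK // posrE ratio_gt0. Qed.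

Lemma ln_sqrt_ratio : ln (Num.sqrt ratio) = ln ratio / 2.
Proof.
have r0 := ratio_gt0.
apply: (canRL (mulfK _)) => //.
by rewrite mulr_natr -lnXn ?sqrtr_gt0 // sqr_sqrtr // ltW.
Qed.

Lemma cutoff_scale_bounds :
  ln #|I|%:R / 2 <= cutoff_scale <= ln #|I|%:R /\ cutoff_scale <= ln ratio / 2.
Proof.
have n1 : 0 <= ln #|I|%:R :> R by rewrite ln_ge0 // ler1n.
have nr : ln #|I|%:R <= ln ratio.
  by rewrite ler_ln ?posrE ?card_gt0R ?ratio_gt0 ?ratio_ge_card.
rewrite /cutoff_scale -/ratio ln_sqrt_ratio le_min ge_min lexx ge_min lexx orbT.
by split => //; rewrite andbT; apply/andP; split; lra.
Qed.

Lemma cutoff_time_ge : #|I|%:R * ln #|I|%:R / 2 <= cutoff_time.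
Proof.
have [/andP[h _] _] := cutoff_scale_bounds.
have /andP[m0 m1] := majority_bounds; have n0 := card_gt0R.
rewrite /cutoff_time -mulrA [_ * #|I|%:R]mulrC -mulrA ler_pM2l //.
have n1 : 0 <= ln #|I|%:R :> R by rewrite ln_ge0 // ler1n.
nra.
Qed.

Lemma rate_cutoff_time alpha : 
  rate * (cutoff_time + alpha * #|I|%:R) = cutoff_scale + alpha / (2 * majority).
Proof.
have /andP[m0 m1] := majority_bounds; have n0 := card_gt0R.
by rewrite /rate /cutoff_time; field; rewrite !gt_eqF //; lra.
Qed.

Lemma alpha_majority alpha : 0 <= alpha -> alpha / 2 <= alpha / (2 * majority).
Proof.
move=> a0; have /andP[m0 m1] := majority_bounds.
by rewrite ler_wpM2l // lef_pV2 ?posrE; lra.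
Qed.

(** Rounding the time down costs at most [1] in [rate * t], hence a factor
[e] in the coupon collector bound and [e^2] in the chi-square exponent. *)
Lemma chain_dist_after alpha : 0 <= alpha ->
  chain_dist P bernoulli (Num.truncn (cutoff_time + alpha * #|I|%:R)) <=
  expR (1 + expR 2) * expR (- (alpha / 2)).
Proof.
move=> a0; set t := Num.truncn _.
have /andP[m0 m1] := majority_bounds; have n0 := card_gt0R.
have r0 := rate_gt0; have r1 := rate_le1; have aM := alpha_majority a0.
have n_r : #|I|%:R <= ratio := ratio_ge_card.
have rt : cutoff_scale + alpha / 2 - 1 <= rate * t%:R.
  have := truncnS_gt (cutoff_time + alpha * #|I|%:R).
  rewrite -/t -natr1 -(ltr_pM2l r0) rate_cutoff_time; nra.
clearbody t.
have expt k : expR (- rate) ^+ k = expR (- (rate * k%:R)).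
  by rewrite -expRM_natr mulNr.
(* The coupon collector bound when the first logarithm is the smaller one,
   the chi-square bound otherwise. *)
have [Le|Le] : cutoff_scale = ln #|I|%:R \/ cutoff_scale = ln ratio / 2.
    rewrite /cutoff_scale -/ratio ln_sqrt_ratio.
    by case: (leP (ln #|I|%:R)); [left|right].
- apply: le_trans (chain_dist_contraction t) _.
  apply: (@le_trans _ _ (#|I|%:R * expR (- rate) ^+ t)).
    rewrite ler_pM2l // lerXn2r ?nnegrE ?expR_ge0 ?expR_ge1Dx //; lra.
  rewrite expt -[X in X * _]expR_ln_card -!expRD ler_expR.
  have := expR_ge0 (2 : R); lra.
apply: chain_dist_chi2; first by rewrite mulr_gt0 ?expR_gt0.
set A := #|I|%:R * _.
have A0 : 0 <= A.
  rewrite mulr_ge0 ?(ltW n0) // mulr_ge0 ?exprn_ge0 ?expR_ge0 // divr_ge0 //; lra.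
have AE : A <= expR (2 - alpha).
  have -> : A = expR (ln ratio) * expR (- (rate * (t + t)%:R)).
    by rewrite expR_ln_ratio -expt /A /ratio; ring.
  rewrite -expRD ler_expR natrD; lra.
have AE2 : A <= expR 2 by rewrite (le_trans AE) // ler_expR; lra.
(* exp A - 1 <= A exp A, where A is small for large alpha and exp A is
   bounded. *)
apply: (@le_trans _ _ (A * expR A)).
  have := expR_ge1Dx (- A); rewrite expRN => h.
  have eA := expR_gt0 A.
  have : (1 - A) * expR A <= 1 by rewrite -ler_pdivlMr // div1r.
  by lra.
apply: (@le_trans _ _ (expR (2 - alpha) * expR (expR 2))).
  by apply: ler_pM => //; rewrite ?expR_ge0 // ler_expR.
rewrite exprMn -!expRM_natr -!expRD ler_expR.
have := expR_ge0 (2 : R); lra.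
Qed.

(** The condition [alpha * n <= cutoff_time] says that the time is not
negative before rounding. *)
Lemma chain_dist_before alpha : (1 < #|I|)%N -> 0 <= alpha ->
  alpha * #|I|%:R <= cutoff_time ->
  1 - 16 * expR 2 * expR (- (alpha / 2)) <=
  chain_dist P bernoulli (Num.truncn (cutoff_time - alpha * #|I|%:R)).
Proof.
move=> I2 a0 alpha_s; set t := Num.truncn _.
have /andP[m0 m1] := majority_bounds; have n0 := card_gt0R.
have n2 : 2 <= #|I|%:R :> R by rewrite ler_nat.
have r0 := rate_gt0; have nr1 := rate_card_le1; have aM := alpha_majority a0.
have n_r : #|I|%:R <= ratio := ratio_ge_card.
have r_lt1 : rate < 1 by nra.
have [/andP[L0 L1] L2] := cutoff_scale_bounds.
have lnn0 : 0 <= ln #|I|%:R :> R by rewrite ln_ge0 // ler1n.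
have lnn : ln #|I|%:R <= #|I|%:R - 1 :> R.
  by rewrite -[X in ln X](subrK 1) addrC le_ln1Dx //; lra.
have rt : rate * t%:R <= cutoff_scale - alpha / 2.
  have : t%:R <= cutoff_time - alpha * #|I|%:R by rewrite truncn_le subr_ge0.
  rewrite -(ler_pM2l r0) -mulNr rate_cutoff_time; lra.
clearbody t.
(* 1 - rate >= exp (- v) for v = rate / (1 - rate).  As rate <= 1 / n, the
   difference v - rate costs at most ln n / (n - 1) <= 1 in the exponent. *)
have drift : (1 - rate) ^+ t >= expR (- (cutoff_scale - alpha / 2 + 1)).
  pose v := rate / (1 - rate).
  have v0 : 0 <= v by rewrite divr_ge0 //; lra.
  have base : expR (- v) <= 1 - rate.
    rewrite expRN -[leRHS]invrK lef_pV2 ?posrE ?expR_gt0 ?invr_gt0; try lra.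
    rewrite (le_trans _ (expR_ge1Dx _)) // /v.
    by rewrite le_eqVlt; apply/orP; left; apply/eqP; field; rewrite gt_eqF //; lra.
  apply: (@le_trans _ _ (expR (- v) ^+ t)); last first.
    by rewrite lerXn2r ?nnegrE ?expR_ge0 //; lra.
  rewrite -expRM_natr ler_expR mulNr lerN2.
  have -> : v * t%:R = rate * t%:R + v * (rate * t%:R).
    by rewrite /v; field; rewrite gt_eqF //; lra.
  have v1 : v * (#|I|%:R - 1) <= 1.
    by rewrite /v mulrAC ler_pdivrMr ?mul1r; lra.
  apply: lerD => //; rewrite (le_trans _ v1) // ler_wpM2l //; lra.
set M := #|I|%:R * majority * (1 - rate) ^+ t.
set E := expR (alpha / 2 - 1); set K := #|I|%:R * expR (- cutoff_scale).
have E0 : 0 < E := expR_gt0 _.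
(* K >= 1 and K^2 >= n (1 - rho) / rho are the two logarithms in the
   minimum.  They bound below M and M^2 / (n rho (1 - rho)). *)
have K1 : 1 <= K.
  rewrite /K -[X in X * _]expR_ln_card -expRD.
  by rewrite -[leLHS]expR0 ler_expR subr_ge0.
have K2 : #|I|%:R * (1 - majority) <= K ^+ 2 * majority.
  have : ratio^-1 <= expR (- cutoff_scale) ^+ 2.
    rewrite -expRM_natr -[X in X^-1]expR_ln_ratio.
    rewrite -expRN ler_expR; lra.
  rewrite -(@ler_pM2l _ (#|I|%:R ^+ 2 * majority)); last first.
    by rewrite mulr_gt0 ?exprn_gt0 //; lra.
  move=> h; apply: le_trans (le_trans h _).
    rewrite le_eqVlt; apply/orP; left; apply/eqP; rewrite /ratio.
    by field; rewrite !gt_eqF //; lra.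
  by rewrite /K exprMn mulrAC.
have ME : K * majority * E <= M.
  rewrite /M /K /E -!mulrA ler_pM2l // mulrCA ler_pM2l; last by lra.
  by rewrite -expRD (le_trans _ drift) // ler_expR; lra.
have ME1 : E / 2 <= M by rewrite (le_trans _ ME) // mulrC ler_pM2r //; nra.
have M0 : 0 < M by lra.
set V := #|I|%:R * (majority * (1 - majority)).
have VM : V * E ^+ 2 <= M ^+ 2.
  apply: (@le_trans _ _ ((K * majority * E) ^+ 2)); last first.
    rewrite lerXn2r ?nnegrE ?(ltW M0) // mulr_ge0 ?(ltW E0) // mulr_ge0 //; lra.
  rewrite [leRHS]exprMn ler_pM2r ?exprn_gt0 // /V mulrCA.
  rewrite (_ : (K * majority) ^+ 2 = majority * (K ^+ 2 * majority)); last by ring.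
  by rewrite ler_pM2l //; lra.
apply: le_trans (chain_dist_lower M0).
rewrite lerD2l lerN2 -/M -/V.
have e : expR (- (alpha / 2)) = E^-1 / expR 1.
  by rewrite /E -expRN -expRN -expRD; congr expR; ring.
have e2 : expR 2 = expR 1 ^+ 2 :> R by rewrite -expRM_natr mul1r.
have e1 : 1 <= expR 1 :> R by have := expR_ge1Dx (1 : R); lra.
have -> : 4 * (2 * V + M) / M ^+ 2 = 8 * (V / M ^+ 2) + 4 * M^-1.
  by field; rewrite gt_eqF.
have V2 : V / M ^+ 2 <= E^-1 ^+ 2.
  by rewrite ler_pdivrMr ?exprn_gt0 // exprVn mulrC ler_pdivlMr ?exprn_gt0.
have V1 : M^-1 <= 2 / E.
  by rewrite -[2 / E]invf_div lef_pV2 ?posrE ?divr_gt0.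
have Ele : E^-1 <= expR 1.
  by rewrite /E -expRN ler_expR; lra.
rewrite e e2 (_ : 16 * _ * _ = 16 * (expR 1 * E^-1)); last by field; rewrite !gt_eqF ?expR_gt0.
have EV0 : 0 < E^-1 by rewrite invr_gt0.
nra.
Qed.

End ProductChain.

(** * From uniform bounds to cutoff *)

Section Limits.
Variable R : realType.

Lemma limn_esup_le (u : (\bar R)^nat) c :
  (\forall k \near \oo%classic, u k <= c)%E -> (limn_esup u <= c)%E.
Proof.
move=> uc; apply: ge_ereal_inf.
exists (ereal_sup [set u k | k in [set k | (u k <= c)%E]]%classic).
  by exists [set k | (u k <= c)%E]%classic.
by apply: ge_ereal_sup => _ [k kc <-].
Qed.

Lemma limn_esup_ge (u : (\bar R)^nat) c :
  (\forall k \near \oo%classic, c <= u k)%E -> (c <= limn_esup u)%E.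
Proof.
move=> uc; apply: le_ereal_inf_tmp => _ [V V_oo <-].
have [k [Vk ck]] := filter_ex (filterI V_oo uc).
by apply: le_ereal_sup_tmp; exists (u k) => //; exists k.
Qed.

Lemma limn_einf_ge (u : (\bar R)^nat) c :
  (\forall k \near \oo%classic, c <= u k)%E -> (c <= limn_einf u)%E.
Proof.
move=> uc; rewrite /limn_einf leeNr; apply: limn_esup_le.
by apply: filterS uc => k; rewrite leeN2.
Qed.

Lemma limn_einf_le (u : (\bar R)^nat) c :
  (\forall k \near \oo%classic, u k <= c)%E -> (limn_einf u <= c)%E.
Proof.
move=> uc; rewrite /limn_einf leeNl; apply: limn_esup_ge.
by apply: filterS uc => k; rewrite leeN2.
Qed.

Lemma expR_half_cvg0 (C : R) :
  (C * expR (- (alpha / 2)) @[alpha --> +oo] --> 0)%classic.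
Proof.
rewrite -[X in (_ --> X)%classic](mulr0 C); apply: cvgMl_tmp.
apply: (cvg_comp (fun alpha : R => alpha / 2) (fun x => expR (- x))); last first.
  exact: cvgr_expR.
by apply: gt0_cvgMly => //; exact: cvg_id.
Qed.

(** For a fixed [alpha] the bounds hold for all large [k] with the same [C],
so they pass to the limits in [k], and the error vanishes as [alpha] grows. *)
Lemma has_cutoff_expR (T : nat -> finType) (P : forall k, 'M[R]_#|T k|)
    (pi : forall k, T k -> R) (s w : nat -> R) (C : R) :
  (forall eps, 0 < eps -> \forall k \near \oo%classic, `|w k| <= eps * `|s k|) ->
  (\forall k \near \oo%classic, forall t, chain_dist (P k) (@pi k) t <= 1) ->
  (forall alpha, 0 <= alpha -> \forall k \near \oo%classic,
    1 - C * expR (- (alpha / 2)) <=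
    chain_dist (P k) (@pi k) (Num.truncn (s k - alpha * w k))) ->
  (forall alpha, 0 <= alpha -> \forall k \near \oo%classic,
    chain_dist (P k) (@pi k) (Num.truncn (s k + alpha * w k)) <=
    C * expR (- (alpha / 2))) ->
  has_cutoff P pi s w.
Proof.
move=> ws le1 before after; split.
- by apply/eqoP.
- apply: (@squeeze_cvge _ _ _ _ (fun alpha => (1 - C * expR (- (alpha / 2)))%:E)
     _ (fun=> 1%E)).
  + near=> alpha; apply/andP; split.
      apply: limn_einf_ge; have a0 : 0 <= alpha by near: alpha; exact: nbhs_pinfty_ge.
      by apply: filterS (before _ a0) => k; rewrite lee_fin.
    by apply: limn_einf_le; apply: filterS le1 => k H; rewrite lee_fin.
  + apply: cvg_EFin; first exact: nearW.
    rewrite -[X in (_ --> X)%classic](subr0 1); apply: cvgB; first exact: cvg_cst.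
    exact: expR_half_cvg0.
  + exact: cvg_cst.
- apply: (@squeeze_cvge _ _ _ _ (fun=> 0%E) _
     (fun alpha => (C * expR (- (alpha / 2)))%:E)).
  + near=> alpha; apply/andP; split.
      by apply: limn_esup_ge; apply: nearW => k; rewrite lee_fin chain_dist_ge0.
    apply: limn_esup_le; have a0 : 0 <= alpha by near: alpha; exact: nbhs_pinfty_ge.
    by apply: filterS (after _ a0) => k; rewrite lee_fin.
  + exact: cvg_cst.
  + apply: cvg_EFin; first exact: nearW.
    exact: expR_half_cvg0.
Unshelve. all: by end_near.
Qed.

End Limits.

(** * The random graph model *)

Lemma erdos_renyi_bernoulli (R : realType) nu (p : R) :
  @erdos_renyi R nu p = @bernoulli R (edge nu) p.
Proof.
apply/funext => x; rewrite /bernoulli (bigID (fun i => x i)) /=.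
rewrite (eq_bigr (fun=> p)) => [|i xi]; last by rewrite /site xi.
rewrite [X in _ * X](eq_bigr (fun=> 1 - p)) => [|i /negPf xi]; last by rewrite /site xi.
rewrite !prodr_const /erdos_renyi.
have -> : weight x = #|[pred i | x i]|.
  by rewrite /weight -sum1_card [RHS]big_mkcond; apply: eq_bigr => i _; rewrite inE; case: (x i).
by rewrite -card_edge -(cardC [pred i | x i]) addKn.
Qed.

Lemma bin2_ge (nu m : nat) : (m.*2.+2 <= nu)%N -> (m <= 'C(nu, 2))%N.
Proof.
move=> h; rewrite bin2 geq_half_double (leq_trans (ltnW (ltnW h))) //.
by rewrite leq_pmulr // -ltnS prednK ?(leq_trans _ h).
Qed.

Theorem corollary22 (R : realType) (p : nat -> R)
    (hp : forall nu : nat, (2 <= nu)%N -> 0 < p 'C(nu, 2) < 1) :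
  let pi (nu : nat) : graph nu -> R := @erdos_renyi R nu (p 'C(nu, 2)) in
  let rho (n : nat) : R := Num.max (p n) (1 - p n) in
  let s (n : nat) : R :=
    2 * rho n * n%:R *
    Num.min (ln n%:R) (ln (Num.sqrt (n%:R * rho n / (1 - rho n)))) in
  has_cutoff (fun nu : nat => lazy_metropolis (pi nu)) pi
    (fun nu : nat => s 'C(nu, 2)) (fun nu : nat => 'C(nu, 2)%:R).
Proof.
move=> pi rho s.
have piE nu : pi nu = @bernoulli R (edge nu) (p 'C(nu, 2)).
  exact: erdos_renyi_bernoulli.
have sE nu : s 'C(nu, 2) = cutoff_time (edge nu) (p 'C(nu, 2)).
  by rewrite /cutoff_time /cutoff_scale card_edge.
have gt0 nu : (2 <= nu)%N -> (0 < #|edge nu|)%N by rewrite card_edge bin_gt0.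
have s_ge nu : (2 <= nu)%N -> 'C(nu, 2)%:R * ln 'C(nu, 2)%:R / 2 <= s 'C(nu, 2).
  move=> nu2; rewrite sE.
  by have := cutoff_time_ge (hp _ nu2) (gt0 _ nu2); rewrite card_edge.
have ln_large (K : R) : \forall nu \near \oo%classic, K <= ln 'C(nu, 2)%:R.
  pose m := (Num.truncn (expR K)).+1.
  exists m.*2.+2 => // nu /= /bin2_ge mn.
  have Km : expR K <= 'C(nu, 2)%:R.
    by rewrite (le_trans (ltW (truncnS_gt _))) // ler_nat.
  by rewrite -[K]expRK ler_ln // posrE ?expR_gt0 // (lt_le_trans (expR_gt0 K)).
have small eps : 0 < eps ->
    \forall nu \near \oo%classic, `|'C(nu, 2)%:R| <= eps * `|s 'C(nu, 2)|.
  move=> eps0; near=> nu.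
  have nu2 : (2 <= nu)%N by near: nu; exists 2%N.
  rewrite ger0_norm //.
  apply: (@le_trans _ _ (eps * ('C(nu, 2)%:R * ln 'C(nu, 2)%:R / 2))).
    have : 2 / eps <= ln 'C(nu, 2)%:R by near: nu; exact: ln_large.
    rewrite ler_pdivrMr // => h.
    rewrite -!mulrA mulrCA ler_peMr // mulrCA mulrA ler_pdivlMr // mul1r mulrC //.
    by rewrite mulrC.
  by rewrite ler_pM2l // (le_trans _ (ler_norm _)) // s_ge.
pose C : R := Num.max (expR (1 + expR 2)) (16 * expR 2).
apply: (@has_cutoff_expR _ _ _ _ _ _ C) => // [|alpha a0|alpha a0].
- exists 2%N => // nu /= nu2 t; rewrite piE.
  exact: chain_dist_le1 (hp _ nu2) (gt0 _ nu2) t.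
  (* This bound on the window relative to s makes s - alpha n nonnegative. *)
- have [e e0 ea] : exists2 e : R, 0 < e & e * alpha <= 1.
    by exists (1 + alpha)^-1; rewrite ?invr_gt0 ?ltr_wpDr // mulrC ler_pdivrMr ?mul1r ?lerDr // ltr_wpDr.
  near=> nu.
  have nu3 : (4 <= nu)%N by near: nu; exists 4%N.
  have nu2 : (2 <= nu)%N by apply: leq_trans nu3.
  have I2 : (1 < #|edge nu|)%N.
    rewrite card_edge; apply: leq_trans (_ : 'C(4, 2) <= _)%N => //.
    exact: leq_bin2l.
  have := @chain_dist_before _ _ _ (hp _ nu2) (gt0 _ nu2) _ I2 a0.
  rewrite -sE -piE card_edge => lower; apply: le_trans (lower _).
    by rewrite lerD2l lerN2 ler_wpM2r ?expR_ge0 // le_max lexx orbT.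
  have : `|'C(nu, 2)%:R| <= e * `|s 'C(nu, 2)| by near: nu; exact: small.
  have s0 : 0 <= s 'C(nu, 2).
    rewrite (le_trans _ (s_ge _ nu2)) //.
    by rewrite divr_ge0 // mulr_ge0 // ln_ge0 // ler1n bin_gt0.
  rewrite ger0_norm // (ger0_norm s0) => h.
  rewrite (le_trans (ler_wpM2l a0 h)) // mulrA ler_piMl // mulrC //.
- exists 2%N => // nu /= nu2.
  have := chain_dist_after (hp _ nu2) (gt0 _ nu2) a0.
  rewrite -sE -piE card_edge => upper; apply: le_trans upper _.
  by rewrite ler_wpM2r ?expR_ge0 // le_max lexx.
Unshelve. all: by end_near.
Qed.
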